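(* Let $\mathbf{i}$ and $\mathbf{j}$ be ideals in $\mathbb{N}$ with $\mathbf{i}\Subset\mathbf{j}$. There exists a maximal $\Subset$-chain having $\mathbf{i}$ as least element and $\mathbf{j}$ as greatest element (maximal, with respect to inclusion, among the $\Subset$-chains with least element $\mathbf{i}$ and greatest element $\mathbf{j}$), and any such maximal $\Subset$-chain is uncountable. In particular, there exists a maximal $\Subset$-chain having the ideal $\mathbf{f}$ of all finite subsets of $\mathbb{N}$ as least element and $2^{\mathbb{N}}$ as greatest element, and any such maximal $\Subset$-chain is uncountable.
   Context: $\mathbb{N}=\{1,2,3,\ldots\}$. A set $\mathbf{i}\subseteq 2^{\mathbb{N}}$ is an ideal in $\mathbb{N}$ if (1) $A,B\in\mathbf{i}$ implies $A\cup B\in\mathbf{i}$, and (2) $A\in\mathbf{i}$ and $B\subseteq A$ imply $B\in\mathbf{i}$. For ideals $\mathbf{i},\mathbf{j}$ in $\mathbb{N}$, we write $\mathbf{i}\Subset\mathbf{j}$ ($\mathbf{j}$ is much larger than $\mathbf{i}$) if $\mathbf{i}\subsetneq\mathbf{j}$ and there exists a countable collection $\{D_j\}_{j\in\mathbb{N}}\subseteq\mathbf{i}$ of non-empty pairwise disjoint sets such that $\bigcup_{k\in K}D_k\in\mathbf{j}\setminus\mathbf{i}$ for every infinite subset $K\subseteq\mathbb{N}$. The relation $\Subset$ is a strict partial order on the set of ideals in $\mathbb{N}$. A $\Subset$-chain is a set of ideals in $\mathbb{N}$ which is strictly totally ordered by $\Subset$. *)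

(* Defs.v *)
From HB Require Import structures.
From mathcomp Require Import all_boot all_classical.

Set Implicit Arguments.
Unset Strict Implicit.
Unset Printing Implicit Defensive.

Local Open Scope classical_set_scope.

(* The set {1, 2, 3, ...} *)
Definition Npos := {n : nat | (0 < n)%N}.
HB.instance Definition _ := Countable.on Npos.

(* Neither non-emptiness nor properness is required: the empty family and the
   full power set [setT] both satisfy this definition. *)
Definition is_ideal (I : set (set Npos)) : Prop :=
  (forall A B, I A -> I B -> I (A `|` B)) /\
  (forall A B, I A -> B `<=` A -> I B).

Definition much_larger (I J : set (set Npos)) : Prop :=
  I `<` J /\
  exists D : Npos -> set Npos,
    [/\ forall k, I (D k),
        forall k, D k !=set0,
        trivIset setT D &
        forall K : set Npos, infinite_set K ->
          (J `\` I) (\bigcup_(k in K) D k)].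

Notation "I ⋐ J" := (much_larger I J) (at level 70, no associativity).

Definition is_chain (C : set (set (set Npos))) : Prop :=
  [/\ forall I, C I -> is_ideal I,
      forall I, C I -> ~ I ⋐ I,
      forall I J L, C I -> C J -> C L -> I ⋐ J -> J ⋐ L -> I ⋐ L &
      forall I J, C I -> C J -> I <> J -> I ⋐ J \/ J ⋐ I].

Definition is_least (C : set (set (set Npos))) (I : set (set Npos)) : Prop :=
  C I /\ forall L, C L -> L <> I -> I ⋐ L.

Definition is_greatest (C : set (set (set Npos))) (J : set (set Npos)) : Prop :=
  C J /\ forall L, C L -> L <> J -> L ⋐ J.

Definition is_chain_between (I J : set (set Npos)) (C : set (set (set Npos))) :
    Prop :=
  [/\ is_chain C, is_least C I & is_greatest C J].

Definition is_maximal_chain_between (I J : set (set Npos))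
    (C : set (set (set Npos))) : Prop :=
  is_chain_between I J C /\
  forall C', is_chain_between I J C' -> C `<=` C' -> C' = C.

Definition fin_ideal : set (set Npos) := [set A | finite_set A].

(* Main.v *)
Require Import Defs.
From mathcomp Require Import all_boot all_classical.

(** Existence is Zorn's lemma: the conditions on a chain between [I] and [J]
    only concern pairs of its elements, so they survive unions of nested
    families.

    For uncountability, a countable chain [C] from [I] to [J] is extended by
    one more ideal.  In an arbitrary gap of [C] there is no evident ideal to
    insert: sets that witness ⋐ between ideals above the gap need not belong
    to the ideals below it.  The gap to be filled is therefore chosen with the
    help of a sequence [D] in [I] witnessing [I ⋐ J].  Since [C] is countable,
    a diagonal argument ([diagonal]) gives an infinite set [S] of indices such
    that each [L] in [C] either contains the union of the [D k] with [k] in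
    [S], or contains no union of infinitely many of these [D k].  This cuts [C] into an
    upper part, which contains [J], and a lower part, which contains [I].  Let
    [U] be the union of the lower part; it is an ideal that contains every
    [D k] but no union of infinitely many [D k] with [k] in [S].

    Now arrange infinitely many of the [D k], [k] in [S], as a matrix indexed by
    [nat * nat], and let [X] be the ideal generated by [U] and the unions of the
    columns ([interpolate]).  The entries of one column witness [L ⋐ X] for each
    [L] in the lower part: infinitely many of them have their union in [X], but
    not in [U].  The columns themselves witness [X ⋐ L] for each [L] in the upper
    part: the union of infinitely many columns is not in [X], because it has a
    column disjoint from any finite number of other columns, and that column is
    not in [U].  So [X] is comparable with all elements of [C], is not one of
    them by irreflexivity, and [C] is not maximal. *)

Set Implicit Arguments.
Unset Strict Implicit.
Unset Printing Implicit Defensive.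

Local Open Scope classical_set_scope.

(** * The relation ⋐ *)

Lemma infinite_image T U (f : T -> U) (K : set T) :
  injective f -> infinite_set K -> infinite_set (f @` K).
Proof.
move=> finj + fK; apply.
have fKinj : {in f @^-1` (f @` K) &, injective f}.
  by move=> ? ? _ _; exact: finj.
by apply: sub_finite_set (finite_preimage fKinj fK); exact: preimage_image.
Qed.

Definition pos_of_nat (n : nat) : Npos := exist _ n.+1 (ltn0Sn n).

Lemma pos_of_nat_inj : injective pos_of_nat.
Proof. by move=> m n []. Qed.

(** Families indexed by [nat] are easier to build by recursion and pairing than
    families indexed by positive integers; this lemma and [much_larger_nat]
    move between the two.  Properness of the inclusion is implied by the
    condition on the infinite set of all indices. *)
Lemma much_larger_family (I J : set (set Npos)) (D : nat -> set Npos) :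
  I `<=` J -> (forall k, I (D k)) -> (forall k, D k !=set0) ->
  trivIset setT D ->
  (forall K, infinite_set K -> (J `\` I) (\bigcup_(k in K) D k)) -> I ⋐ J.
Proof.
move=> IJ ID D0 tD KD; split.
  split => // JI; have [? []] := KD setT infinite_nat; exact: JI.
exists (D \o val); split => //= [|K Kinf].
- by move=> i j _ _ /(tD _ _ Logic.I Logic.I)/val_inj.
- rewrite -(bigcup_image K val D); exact/KD/(infinite_image val_inj).
Qed.

Lemma much_larger_nat (I J : set (set Npos)) : I ⋐ J ->
  exists D : nat -> set Npos,
    [/\ forall k, I (D k), forall k, D k !=set0, trivIset setT D &
        forall K, infinite_set K -> (J `\` I) (\bigcup_(k in K) D k)].
Proof.
move=> [_ [D [ID D0 tD KD]]].
exists (D \o pos_of_nat); split => //= [i j _ _|K Kinf].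
  by move=> /(tD _ _ Logic.I Logic.I)/pos_of_nat_inj.
rewrite -(bigcup_image K pos_of_nat D).
exact/KD/(infinite_image pos_of_nat_inj).
Qed.

Lemma much_larger_sub I J : I ⋐ J -> I `<=` J.
Proof. by case=> -[]. Qed.

Lemma much_larger_irr I : ~ I ⋐ I.
Proof. by case=> -[_ n] _; exact: n. Qed.

Lemma much_larger_subr I J L : I ⋐ J -> J `<=` L -> I ⋐ L.
Proof.
move=> /[dup] /much_larger_sub IJ /much_larger_nat[D [ID D0 tD KD]] JL.
apply: (@much_larger_family _ _ D) => // [|K /KD[? ?]].
  exact: subset_trans JL.
by split => //; exact: JL.
Qed.

Lemma much_larger_trans I J L : I ⋐ J -> J ⋐ L -> I ⋐ L.
Proof. by move=> IJ /much_larger_sub; exact: much_larger_subr. Qed.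

(** * Selecting the cut and filling it *)

Lemma ideal_bigcup_finite I T (D : T -> set Npos) (F : set T) :
  is_ideal I -> I set0 -> (forall k, I (D k)) -> finite_set F ->
  I (\bigcup_(k in F) D k).
Proof.
move=> [IU _] I0 ID; elim/Pchoice : T => T in D F ID *.
by move=> /finite_seqP[s ->]; rewrite bigcup_seq; apply: big_ind.
Qed.

(** Going through the families [R n] one after the other, shrink the current
    infinite set to a member of [R n] if it has an infinite subset there, and
    leave it unchanged otherwise.  An infinite set that is almost contained in
    all terms of this decreasing sequence decides every [R n], because finite
    modifications do not matter. *)
Lemma diagonal (R : nat -> set (set nat)) :
  (forall n A B, R n A -> B `<=` A -> R n B) ->
  (forall n A F, R n A -> finite_set F -> R n (A `|` F)) ->
  exists S, infinite_set S /\
    forall n, R n S \/ forall K, K `<=` S -> infinite_set K -> ~ R n K.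
Proof.
move=> Rsub Rfin.
have step n S : exists S', S' `<=` S /\ (infinite_set S -> infinite_set S') /\
   (R n S' \/ forall K, K `<=` S -> infinite_set K -> ~ R n K).
  have [[K [KS [Kinf RK]]]|noK] :=
    pselect (exists K, K `<=` S /\ infinite_set K /\ R n K).
    by exists K; split => //; split => //; left.
  exists S; split => //; split => //; right=> K KS Kinf RK; apply: noK.
  by exists K.
have [f /all_and2[fS /all_and2[finf fR]]] := choice (fun p => step p.1 p.2).
pose S := fix S n := if n is m.+1 then f (m, S m) else setT.
have Sinf n : infinite_set (S n).
  by elim: n => [|n IHn] /=; [exact: infinite_nat|exact: finf].
have Sdec m n : (m <= n)%N -> S n `<=` S m.
  elim: n => [|n IHn]; first by rewrite leqn0 => /eqP ->.
  rewrite leq_eqVlt => /predU1P[-> //|/IHn]; apply: subset_trans.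
  exact: (fS (n, S n)).
(* Requiring [n <= x] keeps the range of the selected sequence unbounded. *)
have pick n : exists x, S n x /\ (n <= x)%N.
  have /infinite_setN0[x [Sx nx]] := infinite_setD (Sinf n) (finite_II n).
  by exists x; split => //; rewrite leqNgt; exact/negP.
have [s /all_and2[sS ns]] := choice pick.
have almost n : range s `<=` S n `|` s @` `I_n.
  move=> _ [m _ <-]; have [mn|nm] := ltnP m n; first by right; exists m.
  by left; exact: Sdec (sS m).
exists (range s); split.
  move=> /finite_seqP[l sl]; pose N := (\max_(i <- l) i).+1.
  have : [set` l] (s N) by rewrite -sl; exists N.
  move=> /= sNl; have := @leq_bigmax_seq nat l xpredT (fun i => i) _ sNl isT.
  by apply/negP; rewrite -ltnNge; exact: ns.
move=> n; case: (fR (n, S n)) => /= [Rn|noK].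
  left; apply: Rsub (almost n.+1); apply: Rfin => //.
  exact/finite_image/finite_II.
right=> K Ks Kinf RK; apply: (noK (K `&` S n)) => [x [] //||].
  apply: contra_not Kinf => fK.
  apply: (@sub_finite_set _ _ ((K `&` S n) `|` s @` `I_n)).
    by move=> x Kx; have [Sx|] := almost n x (Ks _ Kx); [left|right].
  by rewrite finite_setU; split => //; exact/finite_image/finite_II.
by apply: Rsub RK _ => x [].
Qed.

(** [X] is the ideal generated by [U] and the columns [E m] of the matrix [G].
    It is large enough for column [0] to separate it from the ideals inside
    [U], and small enough for the family of all columns to separate it from
    the ideals that contain the union of the whole matrix. *)
Lemma interpolate (U : set (set Npos)) (G : nat * nat -> set Npos) :
  is_ideal U -> (forall p, U (G p)) -> (forall p, G p !=set0) ->
  trivIset setT G ->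
  (forall K, infinite_set K -> ~ U (\bigcup_(p in K) G p)) ->
  exists X, [/\ is_ideal X,
    forall I, I `<=` U -> (forall p, I (G p)) -> I ⋐ X &
    forall J, is_ideal J -> U `<=` J -> J (\bigcup_p G p) -> X ⋐ J].
Proof.
move=> [UU Usub] UG G0 tG KU.
pose E m := \bigcup_k G (m, k).
pose X := [set Z | exists n A, U A /\ Z `<=` A `|` \bigcup_(m in `I_n) E m].
have EG m : E m `<=` \bigcup_p G p by move=> x [k _ Gx]; exists (m, k).
have inj2 (m : nat) : injective (fun k : nat => (m, k)) by move=> k l [].
have colinf (m : nat) (K : set nat) :
    infinite_set K -> infinite_set [set (m, k) | k in K].
  exact: (infinite_image (@inj2 m)).
have UE m : ~ U (E m).
  rewrite /E -(bigcup_image _ (pair m) G).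
  exact/KU/colinf/infinite_nat.
have UX : U `<=` X by move=> A UA; exists 0, A; split => // x; left.
have XE m : X (E m).
  exists m.+1, (G (0, 0)); split => // x Ex; right; exists m => //=.
have Xsub A B : X A -> B `<=` A -> X B.
  move=> [n [C [UC sAC]]] BA; exists n, C; split => //; exact: subset_trans sAC.
exists X; split.
- split => // A B [m [A' [UA' AA']]] [n [B' [UB' BB']]].
  exists (maxn m n), (A' `|` B'); split; first exact: UU.
  move=> x [/AA'[A'x|[k km Ex]]|/BB'[B'x|[k kn Ex]]].
  + by left; left.
  + by right; exists k => //=; rewrite leq_max km.
  + by left; right.
  + by right; exists k => //=; rewrite leq_max kn orbT.
- move=> I IU IG.
  apply: (@much_larger_family _ _ (fun k => G (0, k))) => //.
  + exact: subset_trans UX.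
  + by move=> i j _ _ /(tG _ _ Logic.I Logic.I)/inj2.
  + move=> K Kinf; split.
      by apply: Xsub (XE 0) _ => x [k Kk Gx]; exists k.
    move=> /IU; rewrite -(bigcup_image _ (pair 0) G); exact/KU/colinf.
- move=> J [JU Jsub] UJ JG.
  have JE K : J (\bigcup_(m in K) E m).
    by apply: Jsub JG _ => x [m _]; exact: EG.
  apply: (@much_larger_family _ _ E) => //.
  + move=> Z [n [A [UA ZA]]]; apply: Jsub ZA; apply: JU => //; exact: UJ.
  + by move=> m; have [x Gx] := G0 (m, 0); exists x, 0.
  + by move=> i j _ _ [x [[k _ xk] [l _ xl]]]; have [] : (i, k) = (j, l)
      by apply: tG => //; exists x.
  + move=> K Kinf; split => // -[n [A [UA KA]]].
    (* Some column [E m] with [m] in [K] is not among the [n] columns used to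
       cover the union, so [A] alone must cover it. *)
    have /infinite_setN0[m [Km nm]] := infinite_setD Kinf (finite_II n).
    apply: (UE m); apply: Usub UA _ => x Ex.
    have [//|[l ln El]] := KA x (ex_intro2 _ _ m Km Ex).
    exfalso; apply: nm => /=.
    case: Ex El => k _ xk [k' _ xk'].
    by have [-> _] : (m, k) = (l, k') by apply: tG => //; exists x.
Qed.

(** The [D k] witnessing [I ⋐ J] lie in every element of [C].  Countability is
    used to thin them out to a family of which each element of [C] contains
    either all unions or no infinite one; the new ideal goes between these two
    kinds of elements, where [interpolate] applies to the union of the lower
    ones. *)
Lemma countable_chain_insert (I J : set (set Npos)) (C : set (set (set Npos))) :
  I ⋐ J -> is_chain_between I J C -> countable C ->
  exists X, [/\ is_ideal X, I ⋐ X, X ⋐ J & forall L, C L -> L ⋐ X \/ X ⋐ L].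
Proof.
move=> IJ [[Cid _ _ Ctot] [CI Imin] [CJ _]] /countable_injP[f finj].
have [D [ID D0 tD KD]] := much_larger_nat IJ.
have Csub L L' : C L -> C L' -> L `<=` L' \/ L' `<=` L.
  move=> CL CL'; have [<-|/eqP LL'] := eqVneq L L'; first by left.
  by case: (Ctot L L' CL CL' LL') => /much_larger_sub; [left|right].
have CD L k : C L -> L (D k).
  move=> CL; have [->//|/eqP LI] := eqVneq L I.
  exact: much_larger_sub (Imin L CL LI) _ (ID k).
have C0 L : C L -> L set0.
  by move=> CL; apply: (Cid L CL).2 (CD L 0 CL) _ => x.
(* The injection [f] enumerates [C] by partial inversion: [R n] concerns the
   only [L] in [C] with [f L = n], and is everything if there is none. *)
pose R n := [set K | forall L, C L -> f L = n -> L (\bigcup_(k in K) D k)].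
have [|n A F RA Ffin|S [Sinf SR]] := diagonal (R := R).
- move=> n A B RA BA L CL fL; apply: (Cid L CL).2 (RA L CL fL) _.
  exact: bigcup_subset.
- move=> L CL fL; rewrite bigcup_setU; apply: (Cid L CL).1; first exact: RA.
  apply: ideal_bigcup_finite => //; [exact: Cid|exact: C0|].
  by move=> k; exact: CD.
have SL L : C L -> ~ L (\bigcup_(k in S) D k) ->
    forall K, K `<=` S -> infinite_set K -> ~ L (\bigcup_(k in K) D k).
  move=> CL LS K KS Kinf LK; have [RS|/(_ K KS Kinf)] := SR (f L).
    by apply: LS; exact: RS.
  by apply=> L' CL' /finj ->//; rewrite inE.
(* [U] is the union of the lower part of the cut. *)
pose U := [set Z | exists L, [/\ C L, ~ L (\bigcup_(k in S) D k) & L Z]].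
have IS : ~ I (\bigcup_(k in S) D k) by have [] := KD S Sinf.
have IU : I `<=` U by move=> Z IZ; exists I.
have Uid : is_ideal U.
  split=> [A B [L [CL LS LA]] [L' [CL' LS' LB]]|A B [L [CL LS LA]] BA].
    have [LL'|LL'] := Csub L L' CL CL'.
      by exists L'; split => //; apply: (Cid L' CL').1 => //; exact: LL'.
    by exists L; split => //; apply: (Cid L CL).1 => //; exact: LL'.
  by exists L; split => //; exact: (Cid L CL).2 LA BA.
have /infiniteP/pcard_leP[g] := Sinf.
pose e (p : nat * nat) : nat := g (pickle p).
have einj : injective e.
  move=> p q /(@inj _ _ _ g) epq.
  by apply/(pcan_inj pickleK)/epq; exact: in_setT.
have eS p : S (e p) by exact: funS.
have GS K : \bigcup_(p in K) D (e p) = \bigcup_(k in e @` K) D k.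
  by rewrite bigcup_image.
have [|||K Kinf|X [Xid XI XJ]] := interpolate (G := D \o e) Uid => //=.
- by move=> p; apply: IU.
- by move=> i j _ _ /(tD _ _ Logic.I Logic.I)/einj.
- rewrite GS => -[L [CL LS]]; apply: SL => //; first by move=> _ [p _ <-].
  exact: infinite_image einj Kinf.
have XB L : C L -> L (\bigcup_(k in S) D k) -> X ⋐ L.
  move=> CL LS; apply: XJ => [|Z [L' [CL' LS' LZ]]|]; first exact: Cid.
    by have [/(_ _ LZ)//|LL'] := Csub L' L CL' CL; case: LS'; exact: LL'.
  apply: (Cid L CL).2 LS _; rewrite GS; apply: bigcup_subset => _ [p _ <-] //.
exists X; split => //.
- by apply: XI => // p; exact: ID.
- by apply: XB => //; have [] := KD S Sinf.
- move=> L CL; have [LS|LS] := pselect (L (\bigcup_(k in S) D k)).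
    by right; exact: XB.
  left; apply: XI => [Z LZ|p]; first by exists L.
  exact: CD.
Qed.

(** * Maximal chains *)

(** The conditions of [is_chain_between] without membership of the end points.
    This form also holds for the empty family and is preserved by unions of
    nested families, as Zorn's lemma requires. *)
Definition pre_chain_between (I J : set (set Npos))
    (C : set (set (set Npos))) : Prop :=
  (forall L, C L -> [/\ is_ideal L, L = I \/ I ⋐ L & L = J \/ L ⋐ J]) /\
  (forall L L', C L -> C L' -> [\/ L = L', L ⋐ L' | L' ⋐ L]).

Lemma chain_betweenE I J C :
  is_chain_between I J C <-> [/\ pre_chain_between I J C, C I & C J].
Proof.
split=> [[[Cid _ _ Ctot] [CI Imin] [CJ Jmax]]|[[Cid Ctot] CI CJ]].
  split=> //; split=> [L CL|L L' CL CL'].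
    split; first exact: Cid.
      by have [|/eqP] := eqVneq L I; [left|right; exact: Imin].
    by have [|/eqP] := eqVneq L J; [left|right; exact: Jmax].
  have [->|/eqP/(Ctot _ _ CL CL')[]] := eqVneq L L';
    by [constructor 1|constructor 2|constructor 3].
split.
- split=> [L /Cid[]//|L _|L L' L'' _ _ _|L L' CL CL' LL'].
  + exact: much_larger_irr.
  + exact: much_larger_trans.
  + by case: (Ctot L L' CL CL'); [|left|right].
- by split=> // L /Cid[_ []].
- by split=> // L /Cid[_ _ []].
Qed.

Lemma pre_chain_between_add I J C X : pre_chain_between I J C ->
  [/\ is_ideal X, X = I \/ I ⋐ X & X = J \/ X ⋐ J] ->
  (forall L, C L -> [\/ L = X, L ⋐ X | X ⋐ L]) ->
  pre_chain_between I J (X |` C).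
Proof.
move=> [Cid Ctot] XX CX; split=> [L [->//|/Cid//]|L L' [->|CL] [->|CL']].
- by constructor 1.
- by case: (CX L' CL'); by [constructor 1|constructor 2|constructor 3].
- by case: (CX L CL); by [constructor 1|constructor 2|constructor 3].
- exact: Ctot.
Qed.

(** A family that is maximal for [pre_chain_between] contains [I] and [J], since
    these are comparable with all its elements and could be added. *)
Lemma exists_maximal_chain I J : is_ideal I -> is_ideal J -> I ⋐ J ->
  exists C, is_maximal_chain_between I J C.
Proof.
move=> Iid Jid IJ.
have [F Fwb Ftot|C [Cwb Cmax]] := @Zorn_bigcup _ (pre_chain_between I J).
  split=> [L [C /Fwb[+ _]]|L L' [C FC CL] [C' FC' CL']]; first exact.
  (* Both elements belong to the larger of the two nested families. *)
  case: (Ftot C C' FC FC') => [/(_ _ CL)|/(_ _ CL')].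
    by move=> ?; exact: (Fwb _ FC').2.
  by move=> ?; exact: (Fwb _ FC).2.
have Cadd X : pre_chain_between I J (X |` C) -> C X.
  move=> XC; apply: contrapT => nCX; apply: (Cmax (X |` C)) => //.
  by split=> [L|/(_ X)]; [right|move=> /(_ (or_introl erefl))].
have CI : C I.
  apply/Cadd/pre_chain_between_add => // [|L /Cwb.1[_ [->|IL] _]].
  - by split=> //; [left|right].
  - by constructor 1.
  - by constructor 3.
have CJ : C J.
  apply/Cadd/pre_chain_between_add => // [|L /Cwb.1[_ _ [->|IL]]].
  - by split=> //; [right|left].
  - by constructor 1.
  - by constructor 2.
exists C; split; first exact/chain_betweenE.
move=> C' /chain_betweenE[C'wb _ _] CC'; apply/eqP/negPn/negP => neq.
by apply: (Cmax C') => //; rewrite properEneq eq_sym.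
Qed.

Lemma maximal_chain_uncountable I J C : I ⋐ J ->
  is_maximal_chain_between I J C -> ~ countable C.
Proof.
move=> IJ [Cbt Cmax] /(countable_chain_insert IJ Cbt)[X [Xid IX XJ CX]].
have [Cwb CI CJ] := (chain_betweenE I J C).1 Cbt.
have : (X |` C) X by left.
rewrite (Cmax (X |` C)); last by move=> L; right.
  by move=> /CX[] /much_larger_irr.
apply/chain_betweenE; split; [|by right|by right].
apply: pre_chain_between_add => //; first by split=> //; right.
by move=> L /CX[]; by [constructor 2|constructor 3].
Qed.

(** * Finite sets *)

Lemma fin_ideal_ideal : is_ideal fin_ideal.
Proof.
split=> A B /= fA; first by move=> fB; rewrite /fin_ideal /= finite_setU.
by move=> BA; exact: sub_finite_set fA.
Qed.

Lemma fin_ideal_lt_setT : fin_ideal ⋐ [set: set Npos].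
Proof.
apply: (@much_larger_family _ _ (fun n => [set pos_of_nat n])) => //.
- by move=> k; exact: finite_set1.
- by move=> k; exists (pos_of_nat k).
- by move=> i j _ _ [x [/= -> /pos_of_nat_inj]].
- move=> K Kinf; split => //; rewrite /fin_ideal /= bigcup_imset1.
  exact: infinite_image pos_of_nat_inj Kinf.
Qed.

Theorem proposition3p5 :
  (forall I J : set (set Npos), is_ideal I -> is_ideal J -> I ⋐ J ->
     (exists C, is_maximal_chain_between I J C) /\
     (forall C, is_maximal_chain_between I J C -> ~ countable C)) /\
  ((exists C, is_maximal_chain_between fin_ideal [set: set Npos] C) /\
   (forall C, is_maximal_chain_between fin_ideal [set: set Npos] C ->
      ~ countable C)).
Proof.
have main I J : is_ideal I -> is_ideal J -> I ⋐ J ->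
    (exists C, is_maximal_chain_between I J C) /\
    (forall C, is_maximal_chain_between I J C -> ~ countable C).
  by move=> *; split; [exact: exists_maximal_chain|
    move=> C; exact: maximal_chain_uncountable].
split=> //; apply: main => //; first exact: fin_ideal_ideal.
exact: fin_ideal_lt_setT.
Qed.
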